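(* The functors $\delta^{n}_{n-1},\kappa^{n}_{n-1}:\mathbb{G}_{n-1,r}\to\mathbb{G}_{n,r}$ and $i^{n-1}_{n}:\mathbb{G}_{n,r}\to\mathbb{G}_{n-1,r}$ ($n\geqslant1$) between the reflexive $n$-globe categories satisfy, for all $n\geqslant 1$, the coglobular identities $$\delta^{n+1}_{n}\delta^{n}_{n-1}=\kappa^{n+1}_{n}\delta^{n}_{n-1},\qquad \delta^{n+1}_{n}\kappa^{n}_{n-1}=\kappa^{n+1}_{n}\kappa^{n}_{n-1}$$ and the coreflexivity identities $$i^{n-1}_{n}\circ\delta^{n}_{n-1}=1_{\mathbb{G}_{n-1,r}}=i^{n-1}_{n}\circ\kappa^{n}_{n-1}.$$ Consequently, applying the contravariant functor $[-;\mathbf{Set}]$ to $(\mathbb{G}_{n,r}^{op})_{n\geqslant0}$ and taking objects yields a reflexive $\omega$-graph (the reflexive $\omega$-graph of the reflexive $\omega$-graphs) with $n$-th set $[\mathbb{G}_{n,r}^{op};\mathbf{Set}](0)$, whose source maps $\sigma^n_{n-1}$, target maps $\beta^n_{n-1}$ and reflexivity maps $\iota^{n-1}_n$ are precomposition with $\delta^n_{n-1}$, $\kappa^n_{n-1}$ and $i^{n-1}_n$ respectively.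
   Context: An $\omega$-graph (globular set, possibly of large sets) is a sequence of sets $X_n$ ($n\geqslant0$) with maps $s,t:X_{n}\to X_{n-1}$ satisfying $ss=st$, $ts=tt$. It is reflexive if equipped with maps $\iota^{n-1}_n:X_{n-1}\to X_n$ ($n\geqslant1$) with $s\iota^{n-1}_n=t\iota^{n-1}_n=\mathrm{id}$. For a category $\mathcal{C}$, $[\mathcal{C}^{op};\mathbf{Set}](0)$ is the (large) set of objects of $[\mathcal{C}^{op};\mathbf{Set}]$. The reflexive $n$-globe categories $\mathbb{G}_{n,r}$ are defined by generators and relations. $\mathbb{G}_{0,r}$: objects $\bar m$ ($m\geqslant0$), generating morphisms $s^{m+1}_m,t^{m+1}_m:\bar m\to\overline{m+1}$ and $1^m_{m+1}:\overline{m+1}\to\bar m$, with relations $s^{m+2}_{m+1}s^{m+1}_m=t^{m+2}_{m+1}s^{m+1}_m$, $s^{m+2}_{m+1}t^{m+1}_m=t^{m+2}_{m+1}t^{m+1}_m$, and $1^m_{m+1}s^{m+1}_m=1^m_{m+1}t^{m+1}_m=1_{\bar m}$. Let $\mathbb{G}_{0,r}'$ be a disjoint copy with objects $\bar m'$ and morphisms $s'^{m+1}_m,t'^{m+1}_m,1'^m_{m+1}$. $\mathbb{G}_{1,r}$ is generated by $\mathbb{G}_{0,r}$, $\mathbb{G}_{0,r}'$ and morphisms $\alpha^m_0:\bar m'\to\bar m$ ($m\geqslant0$), with relations $\alpha^{m+1}_0 s'^{m+1}_m=s^{m+1}_m\alpha^m_0$ and $\alpha^{m+1}_0 t'^{m+1}_m=t^{m+1}_m\alpha^m_0$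 (no relation between the $\alpha^m_0$ and the reflexivity morphisms is imposed). For $n\geqslant2$, $\mathbb{G}_{n,r}$ is generated by $\mathbb{G}_{0,r}$, $\mathbb{G}_{0,r}'$, morphisms $\alpha^m_0,\beta^m_0:\bar m'\to\bar m$ ($m\geqslant0$), morphisms $\alpha_p,\beta_p:\bar p'\to\bar0$ for $1\leqslant p\leqslant n-2$, and $\xi_{n-1}:\overline{n-1}'\to\bar0$. With $\alpha_0:=\alpha^0_0$, $\beta_0:=\beta^0_0$, the relations are: - $\alpha^{m+1}_0 s'^{m+1}_m=s^{m+1}_m\alpha^m_0$, $\alpha^{m+1}_0 t'^{m+1}_m=t^{m+1}_m\alpha^m_0$, and the same with $\beta$; - $\alpha_p s'^p_{p-1}=\beta_p s'^p_{p-1}=\alpha_{p-1}$, $\alpha_p t'^p_{p-1}=\beta_p t'^p_{p-1}=\beta_{p-1}$ for $1\leqslant p\leqslant n-2$; - $\xi_{n-1}s'^{n-1}_{n-2}=\alpha_{n-2}$, $\xi_{n-1}t'^{n-1}_{n-2}=\beta_{n-2}$. Functors $\delta,\kappa$: $\delta^1_0$ sends $\mathbb{G}_{0,r}$ identically to $\mathbb{G}_{0,r}\subset\mathbb{G}_{1,r}$ and $\kappa^1_0$ sends it to the copy $\mathbb{G}_{0,r}'$. For $n\geqslant2$ both $\delta^n_{n-1},\kappa^n_{n-1}$ are the identity on $\mathbb{G}_{0,r}$ and $\mathbb{G}_{0,r}'$. $\delta^2_1:\alpha^m_0\mapsto\alpha^m_0$ and $\kappa^2_1:\alpha^m_0\mapsto\beta^m_0$.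 For $n\geqslant3$ both fix all $\alpha^m_0,\beta^m_0$ and $\alpha_p,\beta_p$ ($1\leqslant p\leqslant n-3$), while $\delta^n_{n-1}(\xi_{n-2})=\alpha_{n-2}$ and $\kappa^n_{n-1}(\xi_{n-2})=\beta_{n-2}$. Functors $i$: $i^0_1$ sends both $\mathbb{G}_{0,r}$ and $\mathbb{G}_{0,r}'$ to $\mathbb{G}_{0,r}$ by the evident identifications and $\alpha^m_0\mapsto1_{\bar m}$. For $n\geqslant2$, $i^{n-1}_n$ is the identity on $\mathbb{G}_{0,r}$ and $\mathbb{G}_{0,r}'$. $i^1_2$ sends $\alpha^m_0\mapsto\alpha^m_0$, $\beta^m_0\mapsto\alpha^m_0$, $\xi_1\mapsto\alpha^0_0\circ1'^0_1$. For $n\geqslant3$, $i^{n-1}_n$ fixes all $\alpha^m_0,\beta^m_0$ and $\alpha_p,\beta_p$ ($0\leqslant p\leqslant n-3$), sends $\alpha_{n-2}$ and $\beta_{n-2}$ to $\xi_{n-2}$, and sends $\xi_{n-1}$ to $\xi_{n-2}\circ1'^{n-2}_{n-1}$. Objects of $[\mathbb{G}_{n,r}^{op};\mathbf{Set}]$ are called reflexive $(n,\omega)$-graphs. *)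

(* Defs.v *)
From HB Require Import structures.
From mathcomp Require Import all_boot.
From mathcomp Require Import boolp.

Set Implicit Arguments.
Unset Strict Implicit.
Unset Printing Implicit Defensive.

Local Open Scope quotient_scope.

Reserved Notation "g \oc f" (at level 50, left associativity).
Reserved Notation "F \oF G" (at level 50, left associativity).
Reserved Notation "q \ow p" (at level 50, left associativity).

(** * Categories, functors, presheaves *)

Record category := Category {
  obj :> Type;
  mor : obj -> obj -> Type;
  idm : forall x, mor x x;
  cmp : forall x y z, mor y z -> mor x y -> mor x z;
  cmp_idl : forall x y (f : mor x y), cmp (idm y) f = f;
  cmp_idr : forall x y (f : mor x y), cmp f (idm x) = f;
  cmpA : forall w x y z (h : mor y z) (g : mor x y) (f : mor w x),
    cmp h (cmp g f) = cmp (cmp h g) f }.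

Arguments mor {c} x y.
Arguments idm {c} x : simpl never.
Arguments cmp {c x y z} g f : simpl never.

Notation "g \oc f" := (cmp g f).

Record functor (C D : category) := Functor {
  fob :> C -> D;
  fmap : forall x y : C, mor x y -> mor (fob x) (fob y);
  fmap_id : forall x : C, fmap (idm x) = idm (fob x);
  fmap_cmp : forall (x y z : C) (g : mor y z) (f : mor x y),
    fmap (g \oc f) = fmap g \oc fmap f }.

Definition idF (C : category) : functor C C :=
  @Functor C C id (fun _ _ f => f) (fun _ => erefl) (fun _ _ _ _ _ => erefl).

Section FunctorComposition.
Variables (C D E : category) (F : functor D E) (G : functor C D).

Fact compF_id x : fmap F (fmap G (idm x)) = idm (F (G x)).
Proof. by rewrite !fmap_id. Qed.

Fact compF_cmp x y z (g : mor y z) (f : mor x y) :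
  fmap F (fmap G (g \oc f)) = fmap F (fmap G g) \oc fmap F (fmap G f).
Proof. by rewrite !fmap_cmp. Qed.

Definition compF : functor C E :=
  @Functor C E (fun x => F (G x)) (fun x y f => fmap F (fmap G f))
    compF_id compF_cmp.
End FunctorComposition.

Notation "F \oF G" := (compF F G).

Definition op (C : category) : category :=
  @Category C (fun x y => @mor C y x) (fun x => idm x)
    (fun x y z g f => f \oc g)
    (fun x y f => cmp_idr f) (fun x y f => cmp_idl f)
    (fun w x y z h g f => esym (cmpA f g h)).

Definition opF (C D : category) (F : functor C D) : functor (op C) (op D) :=
  @Functor (op C) (op D) F (fun x y f => fmap F f)
    (fun x => fmap_id F x) (fun x y z g f => fmap_cmp F f g).

(** Every type is a set here, since [Prop_irrelevance] makes equality proofs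
    unique. *)
Definition SET : category :=
  @Category Type (fun X Y => X -> Y) (fun X => id) (fun X Y Z g f => g \o f)
    (fun _ _ _ => erefl) (fun _ _ _ => erefl) (fun _ _ _ _ _ _ _ => erefl).

Record nattrans (C D : category) (F G : functor C D) := Nattrans {
  ntr :> forall x : C, mor (F x) (G x);
  natural : forall (x y : C) (f : mor x y),
    ntr y \oc fmap F f = fmap G f \oc ntr x }.

Lemma nattrans_ext (C D : category) (F G : functor C D)
  (a b : nattrans F G) : (forall x, a x = b x) -> a = b.
Proof.
case: a b => [a na] [b nb] /= eqab.
have ab : a = b by apply: functional_extensionality_dep.
by rewrite ab in na *; congr Nattrans; apply: Prop_irrelevance.
Qed.

Section FunctorCategory.
Variables C D : category.

Fact idnt_natural (F : functor C D) (x y : C) (f : mor x y) :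
  idm (F y) \oc fmap F f = fmap F f \oc idm (F x).
Proof. by rewrite cmp_idl cmp_idr. Qed.

Definition idnt (F : functor C D) : nattrans F F :=
  Nattrans (@idnt_natural F).

Fact cmpnt_natural (F G H : functor C D) (b : nattrans G H) (a : nattrans F G)
    (x y : C) (f : mor x y) :
  (b y \oc a y) \oc fmap F f = fmap H f \oc (b x \oc a x).
Proof. by rewrite -cmpA natural cmpA natural cmpA. Qed.

Definition cmpnt (F G H : functor C D) (b : nattrans G H) (a : nattrans F G) :
  nattrans F H := Nattrans (cmpnt_natural b a).

Fact cmpnt_idl (F G : functor C D) (a : nattrans F G) : cmpnt (idnt G) a = a.
Proof. by apply: nattrans_ext => x; apply: cmp_idl. Qed.

Fact cmpnt_idr (F G : functor C D) (a : nattrans F G) : cmpnt a (idnt F) = a.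
Proof. by apply: nattrans_ext => x; apply: cmp_idr. Qed.

Fact cmpntA (F G H K : functor C D)
    (c : nattrans H K) (b : nattrans G H) (a : nattrans F G) :
  cmpnt c (cmpnt b a) = cmpnt (cmpnt c b) a.
Proof. by apply: nattrans_ext => x; apply: cmpA. Qed.

Definition funcat : category :=
  @Category (functor C D) (@nattrans C D) idnt cmpnt
    cmpnt_idl cmpnt_idr cmpntA.
End FunctorCategory.

(** The functor [[K; E]] : [[D; E]] -> [[C; E]]. *)
Section Precomposition.
Variables (C D E : category) (K : functor C D).

Definition whisker (F G : functor D E) (a : nattrans F G) :
    nattrans (F \oF K) (G \oF K) :=
  @Nattrans C E (F \oF K) (G \oF K) (fun x => a (K x))
    (fun x y f => natural a (fmap K f)).

Fact whisker_id (F : funcat D E) :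
  whisker (idm F) = @idm (funcat C E) (F \oF K).
Proof. exact: nattrans_ext. Qed.

Fact whisker_cmp (F G H : funcat D E) (b : mor G H) (a : mor F G) :
  whisker (b \oc a) = @cmp (funcat C E) _ _ _ (whisker b) (whisker a).
Proof. exact: nattrans_ext. Qed.

Definition precomp : functor (funcat D E) (funcat C E) :=
  @Functor (funcat D E) (funcat C E) (fun F => F \oF K) whisker
    whisker_id whisker_cmp.
End Precomposition.

(** * Reflexive omega-graphs *)

Record is_omega_graph (X : nat -> Type) (src tgt : forall n, X n.+1 -> X n) :
    Prop := IsOmegaGraph {
  src_src : forall n (x : X n.+2), src n (src n.+1 x) = src n (tgt n.+1 x);
  tgt_src : forall n (x : X n.+2), tgt n (src n.+1 x) = tgt n (tgt n.+1 x) }.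

Record is_reflexive_omega_graph (X : nat -> Type)
    (src tgt : forall n, X n.+1 -> X n) (rfl : forall n, X n -> X n.+1) :
    Prop := IsReflexiveOmegaGraph {
  is_graph : is_omega_graph src tgt;
  src_rfl : forall n (x : X n), src n (rfl n x) = x;
  tgt_rfl : forall n (x : X n), tgt n (rfl n x) = x }.

(** * Categories presented by generators and relations *)

Section Walks.
Variables (V : Type) (E : V -> V -> Type).

(** Formal composites of generators; [wcons g p] stands for [g] after [p]. *)
Inductive walk (x : V) : V -> Type :=
| wnil : walk x x
| wcons y z (g : E y z) (p : walk x y) : walk x z.

Definition wgen x y (g : E x y) : walk x y := wcons g (wnil x).

Fixpoint wcmp x y z (q : walk y z) {struct q} : walk x y -> walk x z :=
  match q in walk _ z return walk x y -> walk x z with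
  | wnil => fun p => p
  | wcons _ _ g q => fun p => wcons g (wcmp q p)
  end.

Lemma wcmp_idr x y (p : walk x y) : wcmp p (wnil x) = p.
Proof. by elim: p => //= u v g p ->. Qed.

Lemma wcmpA w x y z (r : walk y z) (q : walk x y) (p : walk w x) :
  wcmp r (wcmp q p) = wcmp (wcmp r q) p.
Proof. by elim: r q => //= u v g r IHr q; rewrite IHr. Qed.

HB.instance Definition _ x y := gen_eqMixin (walk x y).
HB.instance Definition _ x y := gen_choiceMixin (walk x y).
End Walks.

Arguments wnil {V E} x.
Notation "q \ow p" := (wcmp q p).

Fixpoint wmap (V W : Type) (E : V -> V -> Type) (E' : W -> W -> Type)
    (f : V -> W) (F : forall x y, E x y -> E' (f x) (f y))
    x y (p : walk E x y) : walk E' (f x) (f y) :=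
  match p with
  | wnil => wnil (f x)
  | wcons _ _ g p => wcons (F _ _ g) (wmap F p)
  end.

Section Presentation.
Variables (V : Type) (E : V -> V -> Type).
Variable R : forall x y, walk E x y -> walk E x y -> Prop.

(** The least congruence containing [R]. *)
Inductive wcong : forall x y, walk E x y -> walk E x y -> Prop :=
| wcong_rel x y (p q : walk E x y) : R p q -> wcong p q
| wcong_refl x y (p : walk E x y) : wcong p p
| wcong_sym x y (p q : walk E x y) : wcong p q -> wcong q p
| wcong_trans x y (p q r : walk E x y) :
    wcong p q -> wcong q r -> wcong p r
| wcong_cmp x y z (q q' : walk E y z) (p p' : walk E x y) :
    wcong q q' -> wcong p p' -> wcong (q \ow p) (q' \ow p').

Definition wequiv x y : rel (walk E x y) := fun p q => `[< wcong p q >].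

Fact wequiv_refl x y : reflexive (@wequiv x y).
Proof. by move=> p; apply/asboolP; apply: wcong_refl. Qed.

Fact wequiv_sym x y : symmetric (@wequiv x y).
Proof. by move=> p q; apply/asboolP/asboolP => h; apply: wcong_sym. Qed.

Fact wequiv_trans x y : transitive (@wequiv x y).
Proof.
move=> q p r /asboolP pq /asboolP qr; apply/asboolP.
exact: wcong_trans pq qr.
Qed.

Canonical wequiv_equiv x y :=
  EquivRel (@wequiv x y) (@wequiv_refl x y) (@wequiv_sym x y)
    (@wequiv_trans x y).

Definition pmor x y := {eq_quot (@wequiv x y)}.

Definition pcls x y (p : walk E x y) : pmor x y := \pi p.

Lemma pclsP x y (p q : walk E x y) : pcls p = pcls q <-> wcong p q.
Proof. by split=> [/eqmodP/asboolP|?] //; apply/eqmodP/asboolP. Qed.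

Lemma pclsK x y (a : pmor x y) : pcls (repr a) = a.
Proof. exact: reprK. Qed.

Definition pcmp x y z (b : pmor y z) (a : pmor x y) : pmor x z :=
  pcls (repr b \ow repr a).

Lemma pcmpE x y z (q : walk E y z) (p : walk E x y) :
  pcmp (pcls q) (pcls p) = pcls (q \ow p).
Proof. by apply/pclsP/wcong_cmp; apply/pclsP; rewrite pclsK. Qed.

Fact pcmp_idl x y (a : pmor x y) : pcmp (pcls (wnil y)) a = a.
Proof. by rewrite -[a]pclsK pcmpE. Qed.

Fact pcmp_idr x y (a : pmor x y) : pcmp a (pcls (wnil x)) = a.
Proof. by rewrite -[a]pclsK pcmpE wcmp_idr. Qed.

Fact pcmpA w x y z (c : pmor y z) (b : pmor x y) (a : pmor w x) :
  pcmp c (pcmp b a) = pcmp (pcmp c b) a.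
Proof. by rewrite -[a]pclsK -[b]pclsK -[c]pclsK !pcmpE wcmpA. Qed.

Definition presented : category :=
  @Category V pmor (fun x => pcls (wnil x)) pcmp pcmp_idl pcmp_idr pcmpA.

Definition gen x y (g : E x y) : @mor presented x y := pcls (wgen g).

(** The universal property: a functor out of [presented] is given by the images
    of the generators, provided they satisfy the relations. *)
Section Induced.
Variables (D : category) (f : V -> D).
Variable F : forall x y, E x y -> mor (f x) (f y).

Fixpoint weval x y (p : walk E x y) : mor (f x) (f y) :=
  match p with
  | wnil => idm (f x)
  | wcons _ _ g p => F g \oc weval p
  end.

Lemma weval_cmp x y z (q : walk E y z) (p : walk E x y) :
  weval (q \ow p) = weval q \oc weval p.
Proof.
elim: q p => [|u v g q IHq] p /=; first by rewrite cmp_idl.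
by rewrite IHq cmpA.
Qed.

Hypothesis F_rel : forall x y (p q : walk E x y), R p q -> weval p = weval q.

Lemma weval_cong x y (p q : walk E x y) : wcong p q -> weval p = weval q.
Proof.
elim=> {x y p q} //.
- by move=> x y p q r _ -> _ ->.
- by move=> x y z q q' p p' _ eq _ ep; rewrite !weval_cmp eq ep.
Qed.

Definition induced_fmap (x y : presented) (a : mor x y) : mor (f x) (f y) :=
  weval (repr a).

Lemma induced_cls x y (p : walk E x y) : induced_fmap (pcls p) = weval p.
Proof. by apply/weval_cong/pclsP; rewrite pclsK. Qed.

Fact induced_id (x : presented) : induced_fmap (idm x) = idm (f x).
Proof. exact: (induced_cls (wnil x)). Qed.

Fact induced_cmp (x y z : presented) (b : mor y z) (a : mor x y) :
  induced_fmap (b \oc a) = induced_fmap b \oc induced_fmap a.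
Proof. by rewrite /= [LHS]induced_cls weval_cmp. Qed.

Definition induced : functor presented D :=
  @Functor presented D f induced_fmap induced_id induced_cmp.
End Induced.
End Presentation.

Arguments gen {V E} R {x y} g.

Lemma pcls_rel (V : Type) (E : V -> V -> Type)
    (R : forall x y, walk E x y -> walk E x y -> Prop)
    x y (p q : walk E x y) : R x y p q -> pcls R p = pcls R q.
Proof. by move=> pq; apply/pclsP/wcong_rel. Qed.

Lemma gen_cmp (V : Type) (E : V -> V -> Type)
    (R : forall x y, walk E x y -> walk E x y -> Prop)
    x y z (g : E y z) (f : E x y) :
  gen R g \oc gen R f = pcls R (wgen g \ow wgen f).
Proof. exact: pcmpE. Qed.

Lemma weval_wmap (V W : Type) (E : V -> V -> Type) (E' : W -> W -> Type)
    (u : V -> W) (U : forall x y, E x y -> E' (u x) (u y))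
    (D : category) (f : W -> D) (F : forall x y, E' x y -> mor (f x) (f y))
    x y (p : walk E x y) :
  weval F (wmap U p) = weval (f := f \o u) (fun x y g => F _ _ (U x y g)) p.
Proof. by elim: p => //= v w g p ->. Qed.

Lemma weval_gen (V W : Type) (E : V -> V -> Type) (E' : W -> W -> Type)
    (R' : forall x y, walk E' x y -> walk E' x y -> Prop)
    (u : V -> W) (U : forall x y, E x y -> E' (u x) (u y))
    x y (p : walk E x y) :
  weval (D := presented R') (f := u) (fun x y g => gen R' (U x y g)) p
    = pcls R' (wmap U p).
Proof. by elim: p => //= v w g p ->; rewrite [LHS]pcmpE. Qed.

(** * The reflexive n-globe categories *)

(** The object [m] of [presented rel0] is the object $\bar m$ of G_0. *)
Inductive gen0 : nat -> nat -> Type :=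
| s0 m : gen0 m m.+1
| t0 m : gen0 m m.+1
| r0 m : gen0 m.+1 m. (* the morphism $1^m_{m+1}$ *)

Inductive rel0 : forall x y, walk gen0 x y -> walk gen0 x y -> Prop :=
| rel0_ss m : rel0 (wgen (s0 m.+1) \ow wgen (s0 m))
                   (wgen (t0 m.+1) \ow wgen (s0 m))
| rel0_st m : rel0 (wgen (s0 m.+1) \ow wgen (t0 m))
                   (wgen (t0 m.+1) \ow wgen (t0 m))
| rel0_rs m : rel0 (wgen (r0 m) \ow wgen (s0 m)) (wnil m)
| rel0_rt m : rel0 (wgen (r0 m) \ow wgen (t0 m)) (wnil m).

Definition G0 : category := presented rel0.

Inductive vertex := bar of nat | bar' of nat.

Definition unbar (x : vertex) : nat := match x with bar m | bar' m => m end.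

Inductive gen1 : vertex -> vertex -> Type :=
| in1 m n (g : gen0 m n) : gen1 (bar m) (bar n)
| in1' m n (g : gen0 m n) : gen1 (bar' m) (bar' n)
| al1 m : gen1 (bar' m) (bar m).

Inductive rel1 : forall x y, walk gen1 x y -> walk gen1 x y -> Prop :=
| rel1_in m n (p q : walk gen0 m n) :
    rel0 p q -> rel1 (wmap in1 p) (wmap in1 q)
| rel1_in' m n (p q : walk gen0 m n) :
    rel0 p q -> rel1 (wmap in1' p) (wmap in1' q)
| rel1_s m : rel1 (wgen (al1 m.+1) \ow wgen (in1' (s0 m)))
                  (wgen (in1 (s0 m)) \ow wgen (al1 m))
| rel1_t m : rel1 (wgen (al1 m.+1) \ow wgen (in1' (t0 m)))
                  (wgen (in1 (t0 m)) \ow wgen (al1 m)).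

Definition G1 : category := presented rel1.

(** Generators of G_{k+2}. For [p < k], [al2p] and [be2p] are $\alpha_{p+1}$ and
    $\beta_{p+1}$, so that their indices range over 1, ..., k; [xi2] is
    $\xi_{k+1}$. *)
Inductive gen2 (k : nat) : vertex -> vertex -> Type :=
| in2 m n (g : gen0 m n) : gen2 k (bar m) (bar n)
| in2' m n (g : gen0 m n) : gen2 k (bar' m) (bar' n)
| al2 m : gen2 k (bar' m) (bar m)
| be2 m : gen2 k (bar' m) (bar m)
| al2p p (ltpk : p < k) : gen2 k (bar' p.+1) (bar 0)
| be2p p (ltpk : p < k) : gen2 k (bar' p.+1) (bar 0)
| xi2 : gen2 k (bar' k.+1) (bar 0).

Arguments in2 {k m n} g.
Arguments in2' {k m n} g.
Arguments al2 {k} m.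
Arguments be2 {k} m.
Arguments al2p {k p} ltpk.
Arguments be2p {k p} ltpk.
Arguments xi2 {k}.

(** $\alpha_p$ and $\beta_p$ for 0 <= p <= k, with $\alpha_0 = \alpha^0_0$ and
    $\beta_0 = \beta^0_0$. *)
Definition alpha k p : p <= k -> gen2 k (bar' p) (bar 0) :=
  match p with 0 => fun _ => al2 0 | _.+1 => fun ltpk => al2p ltpk end.

Definition beta k p : p <= k -> gen2 k (bar' p) (bar 0) :=
  match p with 0 => fun _ => be2 0 | _.+1 => fun ltpk => be2p ltpk end.

Inductive rel2 (k : nat) :
    forall x y, walk (gen2 k) x y -> walk (gen2 k) x y -> Prop :=
| rel2_in m n (p q : walk gen0 m n) :
    rel0 p q -> rel2 (wmap (@in2 k) p) (wmap (@in2 k) q)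
| rel2_in' m n (p q : walk gen0 m n) :
    rel0 p q -> rel2 (wmap (@in2' k) p) (wmap (@in2' k) q)
| rel2_als m : rel2 (wgen (al2 m.+1) \ow wgen (in2' (s0 m)))
                    (wgen (in2 (s0 m)) \ow wgen (al2 m))
| rel2_alt m : rel2 (wgen (al2 m.+1) \ow wgen (in2' (t0 m)))
                    (wgen (in2 (t0 m)) \ow wgen (al2 m))
| rel2_bes m : rel2 (wgen (be2 m.+1) \ow wgen (in2' (s0 m)))
                    (wgen (in2 (s0 m)) \ow wgen (be2 m))
| rel2_bet m : rel2 (wgen (be2 m.+1) \ow wgen (in2' (t0 m)))
                    (wgen (in2 (t0 m)) \ow wgen (be2 m))
| rel2_alps p (ltpk : p < k) : rel2 (wgen (al2p ltpk) \ow wgen (in2' (s0 p)))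
                                    (wgen (alpha (ltnW ltpk)))
| rel2_beps p (ltpk : p < k) : rel2 (wgen (be2p ltpk) \ow wgen (in2' (s0 p)))
                                    (wgen (alpha (ltnW ltpk)))
| rel2_alpt p (ltpk : p < k) : rel2 (wgen (al2p ltpk) \ow wgen (in2' (t0 p)))
                                    (wgen (beta (ltnW ltpk)))
| rel2_bept p (ltpk : p < k) : rel2 (wgen (be2p ltpk) \ow wgen (in2' (t0 p)))
                                    (wgen (beta (ltnW ltpk)))
| rel2_xis : rel2 (wgen xi2 \ow wgen (in2' (s0 k))) (wgen (alpha (leqnn k)))
| rel2_xit : rel2 (wgen xi2 \ow wgen (in2' (t0 k))) (wgen (beta (leqnn k))).

Definition G2 (k : nat) : category := presented (@rel2 k).

Definition G (n : nat) : category :=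
  match n with 0 => G0 | 1 => G1 | k.+2 => G2 k end.

(** * The functors delta, kappa and i *)

Definition delta0_gen x y (g : gen0 x y) : @mor G1 (bar x) (bar y) :=
  gen rel1 (in1 g).

Definition kappa0_gen x y (g : gen0 x y) : @mor G1 (bar' x) (bar' y) :=
  gen rel1 (in1' g).

Fact delta0_rel x y (p q : walk gen0 x y) : rel0 p q ->
  weval delta0_gen p = weval delta0_gen q.
Proof.
move=> pq; rewrite !(weval_gen rel1 in1).
by apply/pcls_rel/rel1_in.
Qed.

Fact kappa0_rel x y (p q : walk gen0 x y) : rel0 p q ->
  weval kappa0_gen p = weval kappa0_gen q.
Proof.
move=> pq; rewrite !(weval_gen rel1 in1').
by apply/pcls_rel/rel1_in'.
Qed.

Definition delta0 : functor G0 G1 := induced delta0_rel.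
Definition kappa0 : functor G0 G1 := induced kappa0_rel.

Definition delta1_gen x y (g : gen1 x y) : @mor (G2 0) x y :=
  match g with
  | in1 _ _ g => gen (@rel2 0) (in2 g)
  | in1' _ _ g => gen (@rel2 0) (in2' g)
  | al1 m => gen (@rel2 0) (al2 m)
  end.

Definition kappa1_gen x y (g : gen1 x y) : @mor (G2 0) x y :=
  match g with
  | in1 _ _ g => gen (@rel2 0) (in2 g)
  | in1' _ _ g => gen (@rel2 0) (in2' g)
  | al1 m => gen (@rel2 0) (be2 m)
  end.

Lemma gen2_in k m n (p q : walk gen0 m n) : rel0 p q ->
  weval (D := G2 k) (f := bar) (fun x y g => gen (@rel2 k) (in2 g)) p
  = weval (D := G2 k) (f := bar) (fun x y g => gen (@rel2 k) (in2 g)) q.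
Proof.
move=> pq; rewrite !(weval_gen (@rel2 k) (@in2 k)).
by apply/pcls_rel/rel2_in.
Qed.

Lemma gen2_in' k m n (p q : walk gen0 m n) : rel0 p q ->
  weval (D := G2 k) (f := bar') (fun x y g => gen (@rel2 k) (in2' g)) p
  = weval (D := G2 k) (f := bar') (fun x y g => gen (@rel2 k) (in2' g)) q.
Proof.
move=> pq; rewrite !(weval_gen (@rel2 k) (@in2' k)).
by apply/pcls_rel/rel2_in'.
Qed.

Fact delta1_rel x y (p q : walk gen1 x y) : rel1 p q ->
  weval delta1_gen p = weval delta1_gen q.
Proof.
case=> [m n {}p {}q pq|m n {}p {}q pq|m|m].
- by rewrite !weval_wmap; apply: gen2_in.
- by rewrite !weval_wmap; apply: gen2_in'.
- by rewrite /= !cmp_idr !gen_cmp; apply/pcls_rel/rel2_als.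
- by rewrite /= !cmp_idr !gen_cmp; apply/pcls_rel/rel2_alt.
Qed.

Fact kappa1_rel x y (p q : walk gen1 x y) : rel1 p q ->
  weval kappa1_gen p = weval kappa1_gen q.
Proof.
case=> [m n {}p {}q pq|m n {}p {}q pq|m|m].
- by rewrite !weval_wmap; apply: gen2_in.
- by rewrite !weval_wmap; apply: gen2_in'.
- by rewrite /= !cmp_idr !gen_cmp; apply/pcls_rel/rel2_bes.
- by rewrite /= !cmp_idr !gen_cmp; apply/pcls_rel/rel2_bet.
Qed.

Definition delta1 : functor G1 (G2 0) := induced delta1_rel.
Definition kappa1 : functor G1 (G2 0) := induced kappa1_rel.

(** delta and kappa on G_{k+2}, [c] being the image of $\xi_{k+1}$. *)
Definition dk2_gen k (c : gen2 k.+1 (bar' k.+1) (bar 0))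
    x y (g : gen2 k x y) : @mor (G2 k.+1) x y :=
  match g in gen2 _ x y return @mor (G2 k.+1) x y with
  | in2 _ _ g => gen (@rel2 k.+1) (in2 g)
  | in2' _ _ g => gen (@rel2 k.+1) (in2' g)
  | al2 m => gen (@rel2 k.+1) (al2 m)
  | be2 m => gen (@rel2 k.+1) (be2 m)
  | al2p _ ltpk => gen (@rel2 k.+1) (al2p (leqW ltpk))
  | be2p _ ltpk => gen (@rel2 k.+1) (be2p (leqW ltpk))
  | xi2 => gen (@rel2 k.+1) c
  end.

Definition delta2_gen k := dk2_gen (al2p (ltnSn k)).
Definition kappa2_gen k := dk2_gen (be2p (ltnSn k)).

Lemma dk2_alpha k c p (lepk : p <= k) :
  dk2_gen c (alpha lepk) = gen (@rel2 k.+1) (alpha (leqW lepk)).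
Proof. by case: p lepk => //= p lepk; congr (gen _ (al2p _)). Qed.

Lemma dk2_beta k c p (lepk : p <= k) :
  dk2_gen c (beta lepk) = gen (@rel2 k.+1) (beta (leqW lepk)).
Proof. by case: p lepk => //= p lepk; congr (gen _ (be2p _)). Qed.

Lemma alpha_irr k p (h h' : p <= k) : alpha h = alpha h'.
Proof. by congr alpha; apply: bool_irrelevance. Qed.

Lemma beta_irr k p (h h' : p <= k) : beta h = beta h'.
Proof. by congr beta; apply: bool_irrelevance. Qed.

Lemma dk2_rel k (c : gen2 k.+1 (bar' k.+1) (bar 0)) :
  rel2 (wgen c \ow wgen (in2' (s0 k))) (wgen (alpha (leqnSn k))) ->
  rel2 (wgen c \ow wgen (in2' (t0 k))) (wgen (beta (leqnSn k))) ->
  forall x y (p q : walk (gen2 k) x y), rel2 p q ->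
  weval (dk2_gen c) p = weval (dk2_gen c) q.
Proof.
move=> cs ct x y p q.
case=> [m n {}p {}q pq|m n {}p {}q pq|m|m|m|m|{}p h|{}p h|{}p h|{}p h||].
- by rewrite !weval_wmap; apply: gen2_in.
- by rewrite !weval_wmap; apply: gen2_in'.
- by rewrite /= !cmp_idr !gen_cmp; apply/pcls_rel/rel2_als.
- by rewrite /= !cmp_idr !gen_cmp; apply/pcls_rel/rel2_alt.
- by rewrite /= !cmp_idr !gen_cmp; apply/pcls_rel/rel2_bes.
- by rewrite /= !cmp_idr !gen_cmp; apply/pcls_rel/rel2_bet.
- rewrite /= !cmp_idr dk2_alpha gen_cmp (alpha_irr _ (ltnW (leqW h))).
  exact/pcls_rel/rel2_alps.
- rewrite /= !cmp_idr dk2_alpha gen_cmp (alpha_irr _ (ltnW (leqW h))).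
  exact/pcls_rel/rel2_beps.
- rewrite /= !cmp_idr dk2_beta gen_cmp (beta_irr _ (ltnW (leqW h))).
  exact/pcls_rel/rel2_alpt.
- rewrite /= !cmp_idr dk2_beta gen_cmp (beta_irr _ (ltnW (leqW h))).
  exact/pcls_rel/rel2_bept.
- rewrite /= !cmp_idr dk2_alpha gen_cmp (alpha_irr _ (leqnSn k)).
  exact: pcls_rel.
- rewrite /= !cmp_idr dk2_beta gen_cmp (beta_irr _ (leqnSn k)).
  exact: pcls_rel.
Qed.

Fact delta2_rel k x y (p q : walk (gen2 k) x y) : rel2 p q ->
  weval (@delta2_gen k) p = weval (@delta2_gen k) q.
Proof.
apply: dk2_rel; last by rewrite (beta_irr _ (ltnW (ltnSn k))); apply: rel2_alpt.
by rewrite (alpha_irr _ (ltnW (ltnSn k))); apply: rel2_alps.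
Qed.

Fact kappa2_rel k x y (p q : walk (gen2 k) x y) : rel2 p q ->
  weval (@kappa2_gen k) p = weval (@kappa2_gen k) q.
Proof.
apply: dk2_rel; last by rewrite (beta_irr _ (ltnW (ltnSn k))); apply: rel2_bept.
by rewrite (alpha_irr _ (ltnW (ltnSn k))); apply: rel2_beps.
Qed.

Definition delta2 k : functor (G2 k) (G2 k.+1) := induced (@delta2_rel k).
Definition kappa2 k : functor (G2 k) (G2 k.+1) := induced (@kappa2_rel k).

Definition i0_gen x y (g : gen1 x y) : @mor G0 (unbar x) (unbar y) :=
  match g in gen1 x y return @mor G0 (unbar x) (unbar y) with
  | in1 _ _ g => gen rel0 g
  | in1' _ _ g => gen rel0 g
  | al1 m => @idm G0 m
  end.

Fact i0_rel x y (p q : walk gen1 x y) : rel1 p q ->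
  weval i0_gen p = weval i0_gen q.
Proof.
have W m n (r : walk gen0 m n) :
    weval (D := G0) (f := id) (fun x y g => gen rel0 g) r = pcls rel0 r.
  by elim: r => //= u v g r ->; rewrite [LHS]pcmpE.
case=> [m n {}p {}q pq|m n {}p {}q pq|m|m].
- by rewrite !weval_wmap [LHS]W [RHS]W; apply: pcls_rel.
- by rewrite !weval_wmap [LHS]W [RHS]W; apply: pcls_rel.
- by rewrite /= !cmp_idr !cmp_idl.
- by rewrite /= !cmp_idr !cmp_idl.
Qed.

Definition i0 : functor G1 G0 := induced i0_rel.

(** The generators [al2p] and [be2p] do not exist when [k = 0]. *)
Definition i1_gen x y (g : gen2 0 x y) : @mor G1 x y :=
  match g in gen2 _ x y return @mor G1 x y with
  | in2 _ _ g => gen rel1 (in1 g)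
  | in2' _ _ g => gen rel1 (in1' g)
  | al2 m => gen rel1 (al1 m)
  | be2 m => gen rel1 (al1 m)
  | al2p _ ltp0 => False_rect _ (notF ltp0)
  | be2p _ ltp0 => False_rect _ (notF ltp0)
  | xi2 => gen rel1 (al1 0) \oc gen rel1 (in1' (r0 0))
  end.

Lemma retract_cmp (C : category) (x y z : C) (a : mor y z) (r : mor x y)
    (s : mor y x) : r \oc s = idm y -> (a \oc r) \oc s = a.
Proof. by rewrite -cmpA => ->; rewrite cmp_idr. Qed.

Fact i1_rel x y (p q : walk (gen2 0) x y) : rel2 p q ->
  weval i1_gen p = weval i1_gen q.
Proof.
case=> [m n {}p {}q pq|m n {}p {}q pq|m|m|m|m|//|//|//|//||].
- by rewrite !weval_wmap [LHS](weval_gen rel1 in1) [RHS](weval_gen rel1 in1);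
    apply/pcls_rel/rel1_in.
- by rewrite !weval_wmap [LHS](weval_gen rel1 in1') [RHS](weval_gen rel1 in1');
    apply/pcls_rel/rel1_in'.
- by rewrite /= !cmp_idr !gen_cmp; apply/pcls_rel/rel1_s.
- by rewrite /= !cmp_idr !gen_cmp; apply/pcls_rel/rel1_t.
- by rewrite /= !cmp_idr !gen_cmp; apply/pcls_rel/rel1_s.
- by rewrite /= !cmp_idr !gen_cmp; apply/pcls_rel/rel1_t.
- rewrite /= !cmp_idr retract_cmp // gen_cmp.
  exact/pcls_rel/(rel1_in' (rel0_rs 0)).
- rewrite /= !cmp_idr retract_cmp // gen_cmp.
  exact/pcls_rel/(rel1_in' (rel0_rt 0)).
Qed.

Definition i1 : functor (G2 0) G1 := induced i1_rel.

(** The common image of $\alpha_{p+1}$ and $\beta_{p+1}$ under i when [p = k]. *)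
Definition xi_at k p (eqkp : k = p) : @mor (G2 k) (bar' p.+1) (bar 0) :=
  match eqkp in _ = p return @mor (G2 k) (bar' p.+1) (bar 0) with
  | erefl => gen (@rel2 k) xi2
  end.

Fact eq_of_ltnS k p : p < k.+1 -> ~ p < k -> k = p.
Proof. by rewrite ltnS leq_eqVlt => /orP[/eqP|]. Qed.

Definition i2_gen k x y (g : gen2 k.+1 x y) : @mor (G2 k) x y :=
  match g in gen2 _ x y return @mor (G2 k) x y with
  | in2 _ _ g => gen (@rel2 k) (in2 g)
  | in2' _ _ g => gen (@rel2 k) (in2' g)
  | al2 m => gen (@rel2 k) (al2 m)
  | be2 m => gen (@rel2 k) (be2 m)
  | al2p p ltpk1 =>
      match @idP (p < k) with
      | ReflectT ltpk => gen (@rel2 k) (al2p ltpk)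
      | ReflectF geqpk => xi_at (eq_of_ltnS ltpk1 geqpk)
      end
  | be2p p ltpk1 =>
      match @idP (p < k) with
      | ReflectT ltpk => gen (@rel2 k) (be2p ltpk)
      | ReflectF geqpk => xi_at (eq_of_ltnS ltpk1 geqpk)
      end
  | xi2 => gen (@rel2 k) xi2 \oc gen (@rel2 k) (in2' (r0 k.+1))
  end.

Lemma i2_alpha k p (lepk1 : p <= k.+1) (lepk : p <= k) :
  i2_gen (alpha lepk1) = gen (@rel2 k) (alpha lepk).
Proof.
case: p lepk1 lepk => //= p lepk1 lepk.
by case: {-}_ / idP => // ltpk; congr (gen _ (al2p _)); apply: bool_irrelevance.
Qed.

Lemma i2_beta k p (lepk1 : p <= k.+1) (lepk : p <= k) :
  i2_gen (beta lepk1) = gen (@rel2 k) (beta lepk).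
Proof.
case: p lepk1 lepk => //= p lepk1 lepk.
by case: {-}_ / idP => // ltpk; congr (gen _ (be2p _)); apply: bool_irrelevance.
Qed.

Lemma i2_top k (lekk : k.+1 <= k.+1) :
  i2_gen (alpha lekk) = gen (@rel2 k) xi2
  /\ i2_gen (beta lekk) = gen (@rel2 k) xi2.
Proof.
rewrite /=; case: {-}_ / idP => [h|h]; first by have := h; rewrite {1}ltnn.
by rewrite (Prop_irrelevance (eq_of_ltnS _ _) erefl).
Qed.

Lemma xi_at_s k p (eqkp : k = p) (lepk : p <= k) :
  xi_at eqkp \oc gen (@rel2 k) (in2' (s0 p)) = gen (@rel2 k) (alpha lepk).
Proof.
case: p / eqkp lepk => lepk; rewrite gen_cmp (alpha_irr _ (leqnn k)).
exact/pcls_rel/rel2_xis.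
Qed.

Lemma xi_at_t k p (eqkp : k = p) (lepk : p <= k) :
  xi_at eqkp \oc gen (@rel2 k) (in2' (t0 p)) = gen (@rel2 k) (beta lepk).
Proof.
case: p / eqkp lepk => lepk; rewrite gen_cmp (beta_irr _ (leqnn k)).
exact/pcls_rel/rel2_xit.
Qed.

Fact i2_rel k x y (p q : walk (gen2 k.+1) x y) : rel2 p q ->
  weval (@i2_gen k) p = weval (@i2_gen k) q.
Proof.
case=> [m n {}p {}q pq|m n {}p {}q pq|m|m|m|m|{}p h|{}p h|{}p h|{}p h||].
- by rewrite !weval_wmap; apply: gen2_in.
- by rewrite !weval_wmap; apply: gen2_in'.
- by rewrite /= !cmp_idr !gen_cmp; apply/pcls_rel/rel2_als.
- by rewrite /= !cmp_idr !gen_cmp; apply/pcls_rel/rel2_alt.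
- by rewrite /= !cmp_idr !gen_cmp; apply/pcls_rel/rel2_bes.
- by rewrite /= !cmp_idr !gen_cmp; apply/pcls_rel/rel2_bet.
- rewrite /= !cmp_idr (@i2_alpha k p _ h).
  case: {-}_ / idP => [ltpk|geqpk]; last exact: xi_at_s.
  by rewrite gen_cmp (alpha_irr _ (ltnW ltpk)); apply/pcls_rel/rel2_alps.
- rewrite /= !cmp_idr (@i2_alpha k p _ h).
  case: {-}_ / idP => [ltpk|geqpk]; last exact: xi_at_s.
  by rewrite gen_cmp (alpha_irr _ (ltnW ltpk)); apply/pcls_rel/rel2_beps.
- rewrite /= !cmp_idr (@i2_beta k p _ h).
  case: {-}_ / idP => [ltpk|geqpk]; last exact: xi_at_t.
  by rewrite gen_cmp (beta_irr _ (ltnW ltpk)); apply/pcls_rel/rel2_alpt.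
- rewrite /= !cmp_idr (@i2_beta k p _ h).
  case: {-}_ / idP => [ltpk|geqpk]; last exact: xi_at_t.
  by rewrite gen_cmp (beta_irr _ (ltnW ltpk)); apply/pcls_rel/rel2_bept.
- have -> : weval (@i2_gen k) (wgen (alpha (leqnn k.+1))) = gen (@rel2 k) xi2.
    by rewrite /weval /wgen cmp_idr (i2_top _).1.
  rewrite /= !cmp_idr; apply: (@retract_cmp (G2 k)).
  by rewrite gen_cmp; apply/pcls_rel/(rel2_in' _ (rel0_rs k.+1)).
- have -> : weval (@i2_gen k) (wgen (beta (leqnn k.+1))) = gen (@rel2 k) xi2.
    by rewrite /weval /wgen cmp_idr (i2_top _).2.
  rewrite /= !cmp_idr; apply: (@retract_cmp (G2 k)).
  by rewrite gen_cmp; apply/pcls_rel/(rel2_in' _ (rel0_rt k.+1)).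
Qed.

Definition i2 k : functor (G2 k.+1) (G2 k) := induced (@i2_rel k).

(** [delta n], [kappa n] and [ifun n] are $\delta^{n+1}_n$, $\kappa^{n+1}_n$ and
    $i^n_{n+1}$. *)
Definition delta (n : nat) : functor (G n) (G n.+1) :=
  match n with 0 => delta0 | 1 => delta1 | k.+2 => delta2 k end.

Definition kappa (n : nat) : functor (G n) (G n.+1) :=
  match n with 0 => kappa0 | 1 => kappa1 | k.+2 => kappa2 k end.

Definition ifun (n : nat) : functor (G n.+1) (G n) :=
  match n with 0 => i0 | 1 => i1 | k.+2 => i2 k end.

(** * The reflexive omega-graph of the reflexive omega-graphs *)

(** Reflexive (n,omega)-graphs: the objects of $[G_n^{op}; Set]$. *)
Definition rgraph (n : nat) : Type := obj (funcat (op (G n)) SET).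

Definition sigma_map (n : nat) : rgraph n.+1 -> rgraph n :=
  precomp SET (opF (delta n)).

Definition beta_map (n : nat) : rgraph n.+1 -> rgraph n :=
  precomp SET (opF (kappa n)).

Definition iota_map (n : nat) : rgraph n -> rgraph n.+1 :=
  precomp SET (opF (ifun n)).

(* Main.v *)
Require Import Defs.
From mathcomp Require Import all_boot.
From mathcomp Require Import boolp.

(** The coglobular and coreflexivity identities are equations between functors
    out of categories given by generators and relations. Both sides of each
    equation have the same object map, even definitionally, so by
    [presented_functor_ext] it is enough to compare them on generators, where
    [induced_gen] computes every functor.

    All the functors are the evident ones on the generators that come from G_0
    and from its copy. For the coglobular identities, delta and kappa on G_n
    differ only on its top generators (every alpha^m_0 if n = 1, xi_{n-1} if
    n > 1), and these are not in the image of delta or kappa, which send the top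
    generators one dimension below to an alpha or a beta. For the coreflexivity
    identities, delta and kappa send the top generators to the alpha and to the
    beta that are new in the next dimension; i sends both of these back to the
    top generators, and fixes the alpha and beta that were there before.

    Taking presheaves is contravariantly functorial: precomposition with a
    composite is the composite of the precompositions, and precomposition with
    an identity is the identity. It therefore turns these identities into the
    globular and reflexivity equations for sigma, beta and iota. *)

Set Implicit Arguments.
Unset Strict Implicit.
Unset Printing Implicit Defensive.

(** The object map [f] is shared, rather than assumed equal, so that [m] and
    [m'] have the same type and no transport is needed. *)
Lemma functor_ext (C D : category) (f : C -> D)
    (m m' : forall x y : C, mor x y -> mor (f x) (f y))
    mid mid' mcmp mcmp' :
  (forall x y (a : mor x y), m x y a = m' x y a) ->
  @Functor C D f m mid mcmp = @Functor C D f m' mid' mcmp'.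
Proof.
move=> eqm.
have {}eqm : m = m' by do 3 (apply: functional_extensionality_dep => ?).
by case: m' / eqm mid' mcmp' => *; congr Functor; apply: Prop_irrelevance.
Qed.

Lemma compFA (A B C D : category)
    (H : functor C D) (F : functor B C) (K : functor A B) :
  (H \oF F) \oF K = H \oF (F \oF K).
Proof. exact: functor_ext. Qed.

Lemma compF1 (C D : category) (F : functor C D) : F \oF idF C = F.
Proof. by case: F => f m mid mcmp; apply: functor_ext. Qed.

Lemma opF_comp (C D E : category) (F : functor D E) (K : functor C D) :
  opF F \oF opF K = opF (F \oF K).
Proof. exact: functor_ext. Qed.

Lemma opF_id (C : category) : opF (idF C) = idF (op C).
Proof. exact: functor_ext. Qed.

(** Every morphism of a presented category is a composite of generators, so
    that two functors which agree on generators are equal. *)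
Lemma presented_functor_ext (V : Type) (E : V -> V -> Type)
    (R : forall x y, walk E x y -> walk E x y -> Prop)
    (D : category) (f : presented R -> D)
    (m m' : forall x y : presented R, mor x y -> mor (f x) (f y))
    mid mid' mcmp mcmp' :
  (forall x y (g : E x y), m x y (gen R g) = m' x y (gen R g)) ->
  @Functor (presented R) D f m mid mcmp
    = @Functor (presented R) D f m' mid' mcmp'.
Proof.
move=> eqg; apply: functor_ext => x y a; rewrite -[a]pclsK.
elim: (repr a) => {a y} [|y z g p IHp].
  by transitivity (idm (f x)); [apply: mid | rewrite -mid'].
have -> : pcls R (wcons g p) = @cmp (presented R) _ _ _ (gen R g) (pcls R p).
  by rewrite [RHS]pcmpE.
by rewrite mcmp mcmp' IHp eqg.
Qed.

Lemma induced_gen (V : Type) (E : V -> V -> Type)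
    (R : forall x y, walk E x y -> walk E x y -> Prop)
    (D : category) (f : V -> D) (F : forall x y, E x y -> mor (f x) (f y))
    (F_rel : forall x y (p q : walk E x y), R x y p q -> weval F p = weval F q)
    x y (g : E x y) :
  fmap (induced F_rel) (gen R g) = F x y g.
Proof. by rewrite /= [LHS](induced_cls F_rel) /= cmp_idr. Qed.

Lemma delta_coglobular n :
  delta n.+1 \oF delta n = kappa n.+1 \oF delta n.
Proof.
case: n => [|[|k]]; apply: presented_functor_ext => x y g; rewrite !induced_gen.
- by [].
- by case: g => *; rewrite [LHS]induced_gen [RHS]induced_gen.
- by case: g => *; rewrite [LHS]induced_gen [RHS]induced_gen.
Qed.

Lemma kappa_coglobular n :
  delta n.+1 \oF kappa n = kappa n.+1 \oF kappa n.
Proof.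
case: n => [|[|k]]; apply: presented_functor_ext => x y g; rewrite !induced_gen.
- by [].
- by case: g => *; rewrite [LHS]induced_gen [RHS]induced_gen.
- by case: g => *; rewrite [LHS]induced_gen [RHS]induced_gen.
Qed.

Lemma i_delta n : ifun n \oF delta n = idF (G n).
Proof.
case: n => [|[|k]]; apply: presented_functor_ext => x y g; rewrite !induced_gen.
- by [].
- by case: g => *; rewrite [LHS]induced_gen.
- case: g => [m n g|m n g|m|m|p h|p h|];
    rewrite /delta2_gen /dk2_gen [LHS]induced_gen //.
  + exact: (@i2_alpha k p.+1 _ h).
  + exact: (@i2_beta k p.+1 _ h).
  + exact: (i2_top (ltnSn k)).1.
Qed.

Lemma i_kappa n : ifun n \oF kappa n = idF (G n).
Proof.
case: n => [|[|k]]; apply: presented_functor_ext => x y g; rewrite !induced_gen.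
- by [].
- by case: g => *; rewrite [LHS]induced_gen.
- case: g => [m n g|m n g|m|m|p h|p h|];
    rewrite /kappa2_gen /dk2_gen [LHS]induced_gen //.
  + exact: (@i2_alpha k p.+1 _ h).
  + exact: (@i2_beta k p.+1 _ h).
  + exact: (i2_top (ltnSn k)).2.
Qed.

Lemma precomp_op_comp (A B C E : category) (F : functor B C) (K : functor A B)
    (X : functor (op C) E) :
  precomp E (opF K) (precomp E (opF F) X) = precomp E (opF (F \oF K)) X.
Proof. by rewrite /= compFA opF_comp. Qed.

Lemma precomp_op_id (C E : category) (X : functor (op C) E) :
  precomp E (opF (idF C)) X = X.
Proof. by rewrite /= opF_id compF1. Qed.

Theorem mainTheorem2 :
  (forall n : nat,
     delta n.+1 \oF delta n = kappa n.+1 \oF delta n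
     /\ delta n.+1 \oF kappa n = kappa n.+1 \oF kappa n)
  /\ (forall n : nat,
     ifun n \oF delta n = idF (G n) /\ idF (G n) = ifun n \oF kappa n)
  /\ is_reflexive_omega_graph sigma_map beta_map iota_map.
Proof.
split=> [n|]; first by rewrite delta_coglobular kappa_coglobular.
split=> [n|]; first by rewrite i_delta i_kappa.
split; first split; move=> n x; rewrite /sigma_map /beta_map /iota_map.
- by rewrite !precomp_op_comp delta_coglobular.
- by rewrite !precomp_op_comp kappa_coglobular.
- by rewrite precomp_op_comp i_delta precomp_op_id.
- by rewrite precomp_op_comp i_kappa precomp_op_id.
Qed.
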